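(* Let $n=2$ and $T=1$. There exist a map $v$ satisfying hypothesis ($\mathrm{H}_1$) and a measure $\mu_0\in\mathcal{P}^{ac}_c$ such that the Cauchy problem $\partial_t\mu+\nabla\cdot(v[\mu]\mu)=0$, $\mu_{|t=0}=\mu_0$ has two distinct solutions on $[0,1]$. That is, hypothesis ($\mathrm{H}_1$) does not guarantee uniqueness of the solution.
   Context: Fix $p\ge1$. $\mathcal{P}_p$ is the space of Radon probability measures on $\mathbb{R}^n$ with finite $p$-moment, endowed with the Wasserstein distance $W_p$. $\mathcal{P}^{ac}_c\subset\mathcal{P}_p$ is the set of probability measures with compact support that are absolutely continuous with respect to Lebesgue measure. For absolutely continuous $\mu,\nu$ (identified with their densities), $\|\mu-\nu\|_{L^1}:=\int|\mu(x)-\nu(x)|\,dx$; for general $\mu,\nu\in\mathcal{P}_p$ this is read as the total variation $|\mu-\nu|(\mathbb{R}^n)$. Hypothesis ($\mathrm{H}_1$): $v:\mathcal{P}_p\to C^1(\mathbb{R}^n)\cap L^\infty(\mathbb{R}^n)$, $\mu\mapsto v[\mu]$ (vector fields on $\mathbb{R}^n$), and there are constants $L,M,K$ such that for all $\mu,\nu\in\mathcal{P}_p$, $x,y\in\mathbb{R}^n$: $|v[\mu](x)-v[\mu](y)|\le L|x-y|$, $|v[\mu](x)|\le M$, $\|v[\mu]-v[\nu]\|_{C^0}\le K\,\|\mu-\nu\|_{L^1}$. Solution on $[0,T]$: $\mu\in C([0,T],\mathcal{P}^{ac}_c)$ with $\mu_{|t=0}=\mu_0$ and $\int_0^T\int_{\mathbb{R}^n}(\partial_t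 f+\nabla f\cdot v[\mu_t])\,d\mu_t\,dt=0$ for all $f\in C_c^\infty((0,T)\times\mathbb{R}^n)$. *)

(* Defs.v *)
From HB Require Import structures.
From mathcomp Require Import all_boot all_order all_algebra.
From mathcomp Require Import all_classical all_reals all_analysis.

Set Implicit Arguments.
Unset Strict Implicit.
Unset Printing Implicit Defensive.

Import Order.TTheory GRing.Theory Num.Theory.
Import numFieldNormedType.Exports.

Local Open Scope classical_set_scope.
Local Open Scope ring_scope.

(** The plane is [R * R]: its library topology and differential structure come
    from the max norm, and its measurable sets are the product sigma-algebra,
    i.e. the Borel sets. Lengths are measured by the Euclidean norm below. *)
Definition dot (R : realType) (x y : R * R) : R := x.1 * y.1 + x.2 * y.2.

Definition enorm (R : realType) (x : R * R) : R := Num.sqrt (dot x x).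

Definition plane_lebesgue (R : realType) : set (R * R) -> \bar R :=
  (@lebesgue_measure R \x @lebesgue_measure R)%E.

(** This is the usual class [C^k] when [V] is finite-dimensional: the
    directional derivatives of a differentiable function are then linear
    combinations of its partial derivatives. *)
Fixpoint Ck (R : realType) (V W : normedModType R) (k : nat) (f : V -> W)
    : Prop :=
  match k with
  | 0%N => continuous f
  | k'.+1 => (forall x, differentiable f x) /\
             (forall u : V, Ck k' (fun x => 'D_u f x))
  end.

Definition Cinfty (R : realType) (V W : normedModType R) (f : V -> W) : Prop :=
  forall k, Ck k f.

Section measures.
Context {R : realType}.
Implicit Types (p : R) (mu nu : probability (R * R)%type R).

(** No Radon clause: every Borel probability measure on the plane is Radon. *)
Record Pp p := MkPp {
  Pp_measure :> probability (R * R)%type R;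
  Pp_moment : (\int[Pp_measure]_x ((enorm x) `^ p)%:E < +oo)%E
}.

Definition support mu : set (R * R) :=
  [set x | forall U, open U -> U x -> (0 < mu U)%E].

Definition ac_compact mu : Prop :=
  mu `<< @plane_lebesgue R /\ compact (support mu).

(** Measures are functions on all sets, constrained on measurable
    sets only, so that equality of measures is agreement on measurable sets. *)
Definition same_measure mu nu : Prop :=
  forall A, measurable A -> mu A = nu A.

Definition is_coupling mu nu
    (g : probability ((R * R) * (R * R))%type R) : Prop :=
  forall A, measurable A ->
    g (fst @^-1` A) = mu A /\ g (snd @^-1` A) = nu A.

Definition wasserstein p mu nu : \bar R :=
  (ereal_inf [set (\int[g]_z ((enorm (z.1 - z.2)) `^ p)%:E)
             | g in is_coupling mu nu] `^ p^-1)%E.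

Definition diff_charge mu nu : {charge set (R * R)%type -> \bar R} :=
  cadd (charge_of_finite_measure mu) (copp (charge_of_finite_measure nu)).

(** The total variation [|mu - nu|(R^2)]; it does not depend on the chosen Hahn
    decomposition, and it is [\int |mu(x) - nu(x)| dx] when [mu] and [nu] have
    densities. *)
Definition L1dist mu nu : \bar R :=
  let P := cid (Hahn_decomposition (diff_charge mu nu)) in
  let N := cid (projT2 P) in
  charge_variation (projT2 N) setT.

End measures.

Arguments Pp : clear implicits.

Section transport.
Context {R : realType} {p : R}.
Implicit Type v : Pp R p -> R * R -> R * R.

(** The class [L^oo] needs no separate clause: it follows from the uniform
    bound [M]. *)
Definition H1 v : Prop :=
  (forall mu, Ck 1 (v mu)) /\
  exists L M K : R,
    [/\ forall mu x y, enorm (v mu x - v mu y) <= L * enorm (x - y),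
        forall mu x, enorm (v mu x) <= M &
        forall mu nu,
          (ereal_sup (range (fun x => (enorm (v mu x - v nu x))%:E))
             <= K%:E * L1dist mu nu)%E].

(** Functions of [(t, x)] with [t] in [R] and [x] in the plane. A test function
    on the open strip is represented by its extension by zero. *)
Definition test_function (T : R) (f : R * (R * R) -> R) : Prop :=
  let supp := closure [set z | f z != 0] in
  [/\ Cinfty f, compact supp & supp `<=` [set z | 0 < z.1 < T]].

Definition dt (f : R * (R * R) -> R) (t : R) (x : R * R) : R :=
  'D_((1, (0, 0)) : R * (R * R)) f (t, x).

Definition gradx (f : R * (R * R) -> R) (t : R) (x : R * R) : R * R :=
  ('D_((0, (1, 0)) : R * (R * R)) f (t, x),
   'D_((0, (0, 1)) : R * (R * R)) f (t, x)).

Definition weak_integrand v (mu : R -> Pp R p) (f : R * (R * R) -> R)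
    (t : R) : \bar R :=
  (\int[mu t]_x (dt f t x + dot (gradx f t x) (v (mu t) x))%:E)%E.

(** Continuity of [mu] is with respect to the Wasserstein distance. Since
    the library integral is total, the existence of the time integral in the
    weak formulation has to be required explicitly: [t |-> v (mu t)] need not be
    measurable in general. Values of [mu] outside [[0, T]] are irrelevant. *)
Definition is_solution v (T : R) (mu0 : Pp R p)
    (mu : R -> Pp R p) : Prop :=
  [/\ forall t, t \in `[0, T] -> ac_compact (mu t),
      forall t, t \in `[0, T] ->
        wasserstein p (mu s) (mu t)
          @[s --> within `[0, T] (nbhs t)] --> 0%E,
      same_measure (mu 0) mu0 &
      forall f, test_function T f ->
        (@lebesgue_measure R).-integrable `[0, T] (weak_integrand v mu f) /\
        (\int[@lebesgue_measure R]_(t in `[0%R, T]) weak_integrand v mu f t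
           = 0)%E].

End transport.

(* Main.v *)
Require Import Defs.
From HB Require Import structures.
From mathcomp Require Import all_boot all_order all_algebra.
From mathcomp Require Import all_classical all_reals all_analysis.
From mathcomp Require Import measurable_realfun ring lra.
Set Implicit Arguments.
Unset Strict Implicit.
Unset Printing Implicit Defensive.
Import Order.TTheory GRing.Theory Num.Theory.
Import numFieldNormedType.Exports.
Local Open Scope classical_set_scope.
Local Open Scope ring_scope.

(** Take for [v mu] the constant vector field [- mu {x | x.1 < 0} e_1]. It is
    Lipschitz in [mu] because the mass of a fixed set is, for the total
    variation. Starting from the law of [(U^2, V)], with [U] and [V] independent
    and uniform on [[0, 1]], such a field only translates the measure, and the
    translate [law s] by [- s e_1] gives the half-plane the mass [sqrt s]. Hence
    [law (s t)] is a solution as soon as [s' = sqrt s], and from [s 0 = 0] this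
    equation has the two solutions [a t^2] with [sqrt a = 2 a], i.e. [a = 0] and
    [a = 1/4]. *)

(** * Measurability of Caratheodory functions *)

(* A Caratheodory function is the limit of its values at the points
   [floor (n x) / n], each of which is taken on a countable union of strips. *)
Lemma measurable_fun_caratheodory d (T : measurableType d) (R : realType)
    (f : R * T -> R) :
  (forall x, measurable_fun setT (fun t => f (x, t))) ->
  (forall t, continuous (fun x => f (x, t))) ->
  measurable_fun setT f.
Proof.
move=> mf cf.
pose q (n : nat) (x : R) : R := (Num.floor (n.+1%:R * x))%:~R / n.+1%:R.
pose h (n : nat) (z : R * T) := f (q n z.1, z.2).
have mq n : measurable_fun setT (fun x : R => (n.+1%:R * x)).
  by apply: continuous_measurable_fun => x; exact: mulrl_continuous.
apply: (@measurable_fun_cvg _ _ _ setT h) => [n|[x t] _].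
  move=> _ Y mY; rewrite setTI.
  have -> : h n @^-1` Y = \bigcup_(k in [set: int])
     (((fun x : R => n.+1%:R * x) @^-1` `[k%:~R, (k + 1)%:~R[) `*`
       ((fun t => f (k%:~R / n.+1%:R, t)) @^-1` Y)).
    apply/seteqP; split=> [[x t] Yh|[x t] [k _ [/= xk]]].
      exists (Num.floor (n.+1%:R * x)) => //; split => //=.
      by rewrite in_itv/= floor_le floorD1_gt.
    have -> // : k%:~R / n.+1%:R = q n x.
    by rewrite /q (floor_def (m := k)).
  apply: countable_bigcupT_measurable => [|k]; first exact: countableP.
  apply: measurableX.
    rewrite -[X in measurable X]setTI; exact: mq.
  by rewrite -[X in measurable X]setTI; exact: mf.
have : q n x @[n --> \oo] --> x.
  apply/cvgrPdist_le => /= e e0; near=> n.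
  have n0 : 0 < n.+1%:R :> R by rewrite ltr0n.
  have -> : x - q n x = (n.+1%:R * x - (Num.floor (n.+1%:R * x))%:~R) / n.+1%:R.
    by rewrite mulrBl mulrAC mulfV ?gt_eqF// mul1r.
  rewrite ger0_norm; last first.
    by rewrite divr_ge0 ?ler0n// subr_ge0 floor_le.
  apply: (@le_trans _ _ n.+1%:R^-1).
    rewrite ler_piMl ?invr_ge0 ?ler0n// lerBlDl.
    have := floorD1_gt (n.+1%:R * x).
    rewrite intrD => /ltW; lra.
  apply: ltW; near: n; exact: (near_infty_natSinv_lt (PosNum e0)).
by move=> qx; exact: (cvg_comp _ _ qx (cf t x)).
Unshelve. all: by end_near. Qed.

(** * Null sets under the square map and in products *)

(** Cover [N] by open intervals of small total length. Points of [D] sent into one interval of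
    length l are within C l of each other, so a closed interval of length 2 C l centred at any one
    of them contains them all. This explains the target [e / (2 * C)] for the cover. *)
Lemma lebesgue_null_preimage_expanding (R : realType) (C : R) (f : R -> R)
    (D N : set R) : 0 < C ->
  (forall x y, D x -> D y -> `|x - y| <= C * `|f x - f y|) ->
  measurable (D `&` f @^-1` N) ->
  lebesgue_measure N = 0%E ->
  lebesgue_measure (D `&` f @^-1` N) = 0%E.
Proof.
move=> C0 fC mDN N0; apply/eqP; rewrite eq_le measure_ge0 andbT.
apply/lee_addgt0Pr => e e0; rewrite add0e.
pose l := @wlength R idfun.
have [F NF Fe] : exists2 F, open_itv_cover N F &
    (\sum_(0 <= k <oo) l (F k) <= (e / (2 * C))%:E)%E.
  have d0 : 0 < e / (2 * C) by rewrite divr_gt0// mulr_gt0.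
  have N0' : (l^* N)%mu = 0%E by [].
  have : (l^* N)%mu \is a fin_num by rewrite N0'.
  rewrite outer_measure_open_itv_cover.
  move=> /lb_ereal_inf_adherent-/(_ _ d0)[_/= [F]] NF <-.
  rewrite -outer_measure_open_itv_cover N0' add0e => Fe.
  by exists F => //; exact/ltW.
have l0 k : (0 <= l (F k))%E.
  by have [ab ->] := NF.1 k; exact:
    (@wlength_itv_ge0 _ idfun (fun x y xy => xy)).
have JP k : exists J : set R, [/\ measurable J,
    D `&` f @^-1` F k `<=` J &
    (lebesgue_measure J <= (2 * C)%:E * l (F k))%E].
  (* A point [u] of [D] landing in [F k] serves as centre; if there is none, the empty set is
     enough. *)
  have [[u [Du Fu]]|nu] := pselect (exists u, D u /\ F k (f u)); last first.
    exists set0; split => //; first by move=> u [Du Fu]; apply: nu; exists u.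
    by rewrite measure0 mule_ge0// lee_fin mulr_ge0// ltW.
  have [[a b] /= Fab] := NF.1 k.
  move: Fu; rewrite Fab /= in_itv/= => /andP[au ub].
  exists `[u - C * (b - a), u + C * (b - a)]%classic; split => //.
    move=> y [Dy]; rewrite /= !in_itv/= => /andP[ay yb].
    rewrite -ler_distlC (le_trans (fC _ _ Du Dy))// ler_pM2l// ler_distlC.
    by apply/andP; split; lra.
  rewrite /l wlength_itv/= lte_fin (lt_trans au ub) lebesgue_measure_itv/=.
  rewrite lte_fin; case: ifPn => _; rewrite -!EFinB -EFinM lee_fin; first lra.
  by rewrite !mulr_ge0// ?subr_ge0// ltW//; apply: lt_trans ub.
have [J JP'] := choice JP.
apply: (@le_trans _ _ (\sum_(0 <= k <oo) lebesgue_measure (J k)))%E.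
  apply: measure_sigma_subadditive => //; first by move=> k; have [] := JP' k.
  move=> u [Du Nu]; have [k _ Fk] := NF.2 _ Nu.
  by exists k => //; have [_ + _] := JP' k; apply.
apply: (@le_trans _ _ ((2 * C)%:E * \sum_(0 <= k <oo) l (F k)))%E.
  rewrite -nneseriesZl//.
  by apply: lee_nneseries => // k _; have [] := JP' k.
apply: (@le_trans _ _ ((2 * C)%:E * (e / (2 * C))%:E))%E.
  by apply: lee_pmul => //; rewrite ?nneseries_ge0 ?lee_fin ?mulr_ge0 ?ltW.
by rewrite -EFinM lee_fin mulrC divfK// gt_eqF// mulr_gt0.
Qed.

Lemma measurable_sqrB (R : realType) (s : R) :
  measurable_fun setT (fun u : R => u ^+ 2 - s).
Proof.
apply: continuous_measurable_fun => u.
by apply: cvgB; [exact: exprn_continuous|exact: cvg_cst].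
Qed.

(* The square is expanding away from the origin only: exhaust [0, +oo[. *)
Lemma lebesgue_null_preimage_sqr (R : realType) (s : R) (N : set R) :
  measurable N -> lebesgue_measure N = 0%E ->
  lebesgue_measure (`[0, +oo[%classic `&` (fun u => u ^+ 2 - s) @^-1` N) = 0%E.
Proof.
move=> mN N0; set f := (f in f @^-1` _).
have mf : measurable_fun setT f by exact: measurable_sqrB.
have mP D : measurable D -> measurable (D `&` f @^-1` N).
  by move=> mD; exact: measurable_funTS.
pose D (n : nat) : set R := `[n.+1%:R^-1, +oo[%classic.
have mD n : measurable (D n) by exact: measurable_itv.
have P0 n : lebesgue_measure (D n `&` f @^-1` N) = 0%E.
  apply: (@lebesgue_null_preimage_expanding _ n.+1%:R) => //; last by apply: mP.
  move=> x y; rewrite /D /= !in_itv/= !andbT => nx ny.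
  have n0 : 0 < n.+1%:R^-1 :> R by rewrite invr_gt0.
  (* On [D n] the factor [x + y] is at least 1/(n+1), whence the expansion constant n+1. *)
  have -> : f x - f y = (x + y) * (x - y) by rewrite /f; ring.
  have xy0 : 0 <= x + y by rewrite addr_ge0// (le_trans (ltW n0)).
  rewrite normrM mulrA ler_peMl// (ger0_norm xy0).
  rewrite -[leLHS](@mulfV _ n.+1%:R) ?pnatr_eq0// ler_pM2l ?ltr0n//.
  by rewrite (le_trans nx)// lerDl (le_trans (ltW n0)).
apply/eqP; rewrite eq_le measure_ge0 andbT.
(* The origin lies in no [D n] and is added as a null singleton. *)
apply: (@le_trans _ _ (lebesgue_measure ([set (0 : R)] `|`
    \bigcup_n (D n `&` f @^-1` N)))).
  apply: le_measure; rewrite ?inE.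
  - by apply: mP; exact: measurable_itv.
  - by apply: measurableU => //; apply: bigcupT_measurable => n; apply: mP.
  - move=> u [/=]; rewrite in_itv/= andbT le_eqVlt => /orP[/eqP<-|u0] Nu.
      by left.
    right; have [n _ /(_ n (leqnn n)) nu] := near_infty_natSinv_lt (PosNum u0).
    by exists n => //; split => //; rewrite /D /= in_itv/= andbT ltW.
have mDN : measurable (\bigcup_n (D n `&` f @^-1` N)).
  by apply: bigcupT_measurable => n; apply: mP.
have muD0 : lebesgue_measure (\bigcup_n (D n `&` f @^-1` N)) = 0%E.
  apply/(negligibleP lebesgue_measure mDN).
  apply: negligible_bigcup => n; apply/(negligibleP lebesgue_measure).
    by apply: mP.
  exact: P0.
by rewrite measureU0//; have /= -> := lebesgue_measure_set1 (0 : R).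
Qed.

(** By Tonelli, almost every section of [A] is [n2]-null, hence [m2]-null. The exceptional set is
    pulled back by [f] to an [m1]-null set, and the section of the preimage at [x] is that of [A] at
    [f x]. *)
Lemma product_null_preimage d1 d1' d2 (T1 : measurableType d1)
    (T1' : measurableType d1') (T2 : measurableType d2) (R : realType)
    (m1 : {sigma_finite_measure set T1 -> \bar R})
    (n1 : {sigma_finite_measure set T1' -> \bar R})
    (m2 n2 : {sigma_finite_measure set T2 -> \bar R})
    (f : T1 -> T1') (A : set (T1' * T2)) :
  measurable_fun setT f ->
  (forall N, measurable N -> n1 N = 0%E -> m1 (f @^-1` N) = 0%E) ->
  m2 `<< n2 -> measurable A -> (n1 \x n2)%E A = 0%E ->
  (m1 \x m2)%E ((fun z => (f z.1, z.2)) @^-1` A) = 0%E.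
Proof.
move=> mf fN /null_content_dominatesP m2n2 mA nA0.
have mn2 := measurable_fun_xsection n2 mA.
have [N [mN N0 AN]] : {ae n1, forall x, setT x -> n2 (xsection A x) = 0%E}.
  apply/(ae_eq_integral_abs n1 measurableT (f := n2 \o xsection A)) => //.
  by rewrite -[RHS]nA0; apply: eq_integral => x _ /=; rewrite gee0_abs.
have mF : measurable_fun setT (fun z : T1 * T2 => (f z.1, z.2)).
  by apply/measurable_fun_pair => //; exact: measurableT_comp.
set B := _ @^-1` A.
have mB : measurable B by rewrite -[B]setTI; exact: mF.
have mm2 := measurable_fun_xsection m2 mB.
rewrite /product_measure1 -(@integral0 _ _ _ m1 setT).
apply: ae_eq_integral => //.
exists (f @^-1` N); split => [||x /= Bx].
- by rewrite -[X in measurable X]setTI; exact: mf.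
- exact: fN.
apply: AN => /= Ax; apply: Bx => _.
have -> : xsection B x = xsection A (f x).
  by apply/seteqP; split => y; rewrite /xsection /B /= !inE.
by apply: m2n2; [exact: measurable_xsection|exact: Ax].
Qed.

(** * The translated laws: density, support and mass of the left half-plane *)

Section roughened_square.
Context {R : realType}.
Implicit Types (s t : R) (z : R * R).

(* Lebesgue measure lives on [measurableTypeR R], which has the sets of [R] but
   another display, hence the two copies of the plane. *)
Let plane := (measurableTypeR R * measurableTypeR R)%type.

Definition unit_prob : probability (measurableTypeR R) R :=
  uniform_prob (@ltr01 R).

Definition square_prob : probability plane R := (unit_prob \x unit_prob)%E.

Definition shift_sqr s (z : plane) : R * R := ((z.1 : R) ^+ 2 - s, z.2).

Lemma measurable_shift_sqr s : measurable_fun setT (shift_sqr s).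
Proof.
apply: measurable_fun_pair => //.
exact: (measurableT_comp (measurable_sqrB s)).
Qed.

HB.instance Definition _ s := isMeasurableFun.Build _ _ _ _ (shift_sqr s)
  (measurable_shift_sqr s).

Definition law s : probability (R * R)%type R :=
  distribution square_prob (shift_sqr s).

Lemma unit_probE (A : set R) : measurable A ->
  unit_prob A = lebesgue_measure (`[0, 1]%classic `&` A).
Proof.
move=> mA; rewrite /unit_prob /= /uniform_prob integral_uniform_pdf.
rewrite (eq_integral (fun=> 1%E)); last first.
  move=> x; rewrite inE => -[_] /=; rewrite /uniform_pdf in_itv/= => ->.
  by rewrite subr0 invr1.
by rewrite integral_cst ?mul1e 1?setIC//; exact: measurableI.
Qed.

Lemma law_dominated s : law s `<< @plane_lebesgue R.
Proof.
move=> B B0 A mA /(B0 _ mA) A0.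
have := @product_null_preimage _ _ _ _ _ _ _ unit_prob lebesgue_measure
  unit_prob lebesgue_measure (fun u : measurableTypeR R => (u : R) ^+ 2 - s) A.
apply => //; [exact: measurable_sqrB| |exact: dominates_uniform_prob].
move=> N mN N0.
have mP : measurable ((fun u : R => u ^+ 2 - s) @^-1` N).
  by rewrite -[X in measurable X]setTI; exact: measurable_sqrB.
apply: etrans (unit_probE mP) _.
(* [unit_prob] only sees [0, 1], which lies in the half-line where the square pulls null sets back
   to null sets. *)
apply: (subset_measure0 (mu := lebesgue_measure)
  (B := `[0, +oo[%classic `&` (fun u : R => u ^+ 2 - s) @^-1` N)).
- by apply: measurableI => //; exact: measurable_itv.
- by apply: measurableI => //; exact: measurable_itv.
- by apply: setSI => u /=; rewrite !in_itv/= andbT => /andP[].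
- exact: lebesgue_null_preimage_sqr.
Qed.

Lemma square_prob_unit : square_prob (`[0, 1] `*` `[0, 1]) = 1%E.
Proof.
rewrite /square_prob /= product_measure1E//= unit_probE// setIid.
by rewrite lebesgue_measure_itv/= lte_fin ltr01 oppr0 adde0 mule1.
Qed.

(** The unit square has full mass and [shift_sqr s] sends it into this box. The box then controls
    both the support and the moments. *)
Lemma law_box s : law s (`[- s, 1 - s] `*` `[0, 1]) = 1%E.
Proof.
apply/eqP; rewrite eq_le probability_le1//=; last exact: measurableX.
rewrite -square_prob_unit; apply: le_measure; rewrite ?inE.
- exact: measurableX.
- by rewrite -[X in measurable X]setTI; apply: measurable_shift_sqr => //;
    exact: measurableX.
- move=> [u v] /= []; rewrite !in_itv/= => /andP[u0 u1] v01; split => //.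
  by rewrite -{1}[- s]add0r !lerD2r sqr_ge0 expr_le1.
Qed.

Lemma support_subset_closed (mu : probability (R * R)%type R)
    (K : set (R * R)) :
  measurable K -> closed K -> mu K = 1%E -> Defs.support mu `<=` K.
Proof.
move=> mK cK K1 x xs; apply: contrapT => nKx.
have := xs (~` K) (closed_openC cK) nKx.
by rewrite probability_setC// K1 subee// ltxx.
Qed.

Lemma closed_support (mu : probability (R * R)%type R) :
  closed (Defs.support mu).
Proof.
move=> x xs U oU Ux; have [y [ys Uy]] := xs U (open_nbhs_nbhs (conj oU Ux)).
exact: ys.
Qed.

Lemma law_ac_compact s : ac_compact (law s).
Proof.
split; first exact: law_dominated.
have cK : compact (`[- s, 1 - s]%classic `*` `[0, 1]%classic : set (R * R)).
  by apply: compact_setX; exact: segment_compact.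
apply: (subclosed_compact (@closed_support _) cK).
apply: support_subset_closed.
- exact: measurableX.
- apply: compact_closed => //; exact: norm_hausdorff.
- exact: law_box.
Qed.

Lemma left_halfE : [set x : R * R | x.1 < 0] = `]-oo, 0[%classic `*` setT.
Proof. by apply/seteqP; split=> [x|x []]/=; rewrite in_itv. Qed.

(** For u in [0, 1], u^2 < s means u < sqrt s, and [s <= 1] keeps [0, sqrt s[ inside [0, 1]. The
    failure of the Lipschitz property of sqrt at 0 is the source of non-uniqueness. *)
Lemma law_left_half s : 0 <= s <= 1 ->
  law s [set x | x.1 < 0] = (Num.sqrt s)%:E.
Proof.
move=> /andP[s0 s1].
rewrite left_halfE.
have mA : measurable ((fun u : R => u ^+ 2 - s) @^-1` `]-oo, 0[%classic).
  by rewrite -[X in measurable X]setTI; exact: measurable_sqrB.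
transitivity (square_prob
    (((fun u : R => u ^+ 2 - s) @^-1` `]-oo, 0[%classic) `*` setT)) => //.
rewrite /square_prob /= product_measure1E//.
rewrite -[RHS]mule1 -(probability_setT unit_prob).
congr (_ * _)%E; apply: etrans (unit_probE mA) _.
rewrite (_ : _ `&` _ = `[0, Num.sqrt s[%classic); last first.
  apply/seteqP; split=> u /=; rewrite !in_itv/= subr_lt0.
    move=> [/andP[u0 _]]; rewrite u0/= -[X in _ < X -> _](sqr_sqrtr s0).
    by rewrite ltr_pXn2r// ?nnegrE ?sqrtr_ge0.
  move=> /andP[u0 us]; rewrite u0 -[X in _ < X](sqr_sqrtr s0).
  rewrite ltr_pXn2r// ?nnegrE ?sqrtr_ge0//.
  split => //; rewrite (le_trans (ltW us))//.
  by rewrite -[leRHS]sqrtr1 ler_sqrt.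
rewrite lebesgue_measure_itv/= lte_fin; case: ifPn => [_|].
  by rewrite oppr0 adde0.
by rewrite -leNgt => s0'; congr _%:E; apply/eqP; rewrite eq_le sqrtr_ge0.
Qed.

End roughened_square.

(** * Moments and Wasserstein distances of the laws *)

Section euclidean_norm.
Context {R : realType}.
Implicit Types x : R * R.

Lemma enormE (a b : R) : enorm (a, b) = Num.sqrt (a ^+ 2 + b ^+ 2).
Proof. by []. Qed.

Lemma enorm_axis (a : R) : enorm (a, 0) = `|a|.
Proof. by rewrite enormE expr0n addr0 sqrtr_sqr. Qed.

Lemma enorm_le_sum x : enorm x <= `|x.1| + `|x.2|.
Proof.
case: x => a b; rewrite enormE -[leRHS]ger0_norm ?addr_ge0//= -sqrtr_sqr.
rewrite ler_wsqrtr// -[a ^+ 2]real_normK ?num_real//.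
rewrite -[b ^+ 2]real_normK ?num_real// sqrrD addrAC lerDl mulrn_wge0//.
Qed.

Lemma measurable_enorm : measurable_fun setT (@enorm R).
Proof.
apply: (measurableT_comp (f := @Num.sqrt R)).
  by apply: continuous_measurable_fun; exact: sqrt_continuous.
by apply: measurable_funD; apply: measurable_funM.
Qed.

Lemma measurable_enorm_powR (p : R) :
  measurable_fun setT (fun x => enorm x `^ p).
Proof.
exact: (measurableT_comp (@measurable_powR R p) measurable_enorm).
Qed.

End euclidean_norm.

(** The complement of [K] is negligible, so the bound on [K] alone can be integrated against a total
    mass of 1. *)
Lemma ge0_integral_le_sure d (T : measurableType d) (R : realType)
    (P : probability T R) (K : set T) (f : T -> R) (C : R) :
  measurable K -> P K = 1%E -> measurable_fun setT f ->
  (forall x, 0 <= f x) -> (forall x, K x -> f x <= C) ->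
  (\int[P]_x (f x)%:E <= C%:E)%E.
Proof.
move=> mK K1 mf f0 fC.
have mf' : measurable_fun setT (EFin \o f) by exact/measurable_EFinP.
have nK : P (~` K) = 0%E by rewrite probability_setC// K1 subee.
have f0' x : [set: T] x -> (0 <= (f x)%:E)%E by rewrite lee_fin.
have mCK := measurableC mK.
rewrite (ge0_negligible_integral mCK measurableT mf' f0' nK).
rewrite setDE setCK setTI.
apply: (@le_trans _ _ (\int[P]_(x in K) C%:E)%E).
  apply: ge0_le_integral => //.
  - by move=> x _; exact: f0'.
  - exact: measurable_funTS.
by rewrite integral_cst// [X in (_ * X)%E]K1 mule1.
Qed.

Section moving_law.
Context {R : realType}.
Implicit Types s t p : R.

Lemma law_moment p s : 0 <= p ->
  (\int[law s]_x ((enorm x) `^ p)%:E < +oo)%E.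
Proof.
move=> p0.
apply: (@le_lt_trans _ _ ((`|s| + 2) `^ p)%:E); last exact: ltry.
apply: (@ge0_integral_le_sure _ _ _ (law s)
  (`[- s, 1 - s]%classic `*` `[0, 1]%classic) (fun x => enorm x `^ p)).
- exact: measurableX.
- exact: law_box.
- exact: measurable_enorm_powR.
- by move=> x; exact: powR_ge0.
move=> x [] /=; rewrite !in_itv/= => /andP[s1 s2] /andP[x0 x1].
have e0 : 0 <= enorm x by exact: sqrtr_ge0.
apply: ge0_ler_powR; rewrite ?nnegrE// ?addr_ge0//.
apply: (le_trans (enorm_le_sum x)).
rewrite (ger0_norm x0) (_ : 2 = 1 + 1)// addrA lerD// ler_norml.
by have := ler_norm s; have := ler_norm (- s); rewrite normrN => *;
  apply/andP; split; lra.
Qed.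

Definition Plaw p (p1 : 1 <= p) s : Pp R p :=
  MkPp (law_moment s (le_trans ler01 p1)).

(** Its distribution under [square_prob] is a coupling of [law s] and [law t]. *)
Definition shift_sqr2 s t z := (@shift_sqr R s z, shift_sqr t z).

Lemma measurable_shift_sqr2 s t : measurable_fun setT (shift_sqr2 s t).
Proof. by apply: measurable_fun_pair; exact: measurable_shift_sqr. Qed.

HB.instance Definition _ s t :=
  isMeasurableFun.Build _ _ _ _ (shift_sqr2 s t) (measurable_shift_sqr2 s t).

(* Couple the two laws through the same point of the square. *)
Lemma wasserstein_law p s t : 0 < p ->
  (wasserstein p (law s) (law t) <= `|s - t|%:E)%E.
Proof.
move=> p0.
pose g : probability _ R := distribution (@square_prob R) (shift_sqr2 s t).
have gE : (\int[g]_z ((enorm (z.1 - z.2)) `^ p)%:E = (`|s - t| `^ p)%:E)%E.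
  rewrite ge0_integral_distribution//=; last 2 first.
    apply/measurable_EFinP; apply: (measurableT_comp (measurable_enorm_powR p)).
    by apply: measurable_fun_pair; apply: measurable_funB;
      (apply: measurableT_comp => //; exact: measurableT_comp).
    by move=> z; rewrite lee_fin powR_ge0.
  (* The two images of a point of the square differ by [(t - s, 0)], so the transport cost is
     constant. *)
  under eq_integral.
    move=> z _.
    rewrite /= /shift_sqr [X in enorm X](_ : _ = (t - s, 0)); last first.
      by congr pair => /=; ring.
    rewrite enorm_axis distrC; over.
  rewrite integral_cst//= -[RHS]mule1.
  by rewrite -(@probability_setT _ _ _ (@square_prob R)).
have gc : is_coupling (law s) (law t) g by [].
rewrite /wasserstein.
apply: (@le_trans _ _ ((`|s - t| `^ p)%:E `^ p^-1)%E); last first.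
  by rewrite poweR_EFin -powRrM mulfV ?gt_eqF// powRr1.
have i0 : (0 <= ereal_inf [set (\int[g]_z ((enorm (z.1 - z.2)) `^ p)%:E)
             | g in is_coupling (law s) (law t)])%E.
  apply: le_ereal_inf_tmp => _ [h _ <-]; apply: integral_ge0 => z _.
  by rewrite lee_fin powR_ge0.
apply: gt0_ler_poweR; rewrite ?invr_ge0 ?(ltW p0)// ?in_itv/= ?i0 ?leey//.
  by rewrite lee_fin powR_ge0.
by apply: ereal_inf_lbound; exists g.
Qed.

End moving_law.

(** * The velocity field and its regularity *)

Section drift.
Context {R : realType} {p : R}.
Implicit Types (mu nu : Pp R p) (x : R * R).

Definition drift mu x : R * R := (- fine (mu [set x | x.1 < 0]), 0).

Lemma measurable_left_half : measurable [set x : R * R | x.1 < 0].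
Proof. by rewrite left_halfE; exact: measurableX. Qed.

(** The field is constant in space, so L = 0; a mass is at most 1, so M = 1; and |mu A - nu A| <=
    |mu - nu|(A) <= |mu - nu|(R^2) gives K = 1. *)
Lemma drift_H1 : H1 drift.
Proof.
split.
  move=> mu; split => [x|u x]; first exact: differentiable_cst.
  have -> : (fun x => 'D_u (drift mu) x) = cst 0.
    by apply/funext => y; exact: derive_cst.
  exact: cvg_cst.
exists 0, 1, 1; split.
- by move=> mu x y; rewrite /drift subrr mul0r enorm_axis normr0.
- move=> mu x; rewrite enorm_axis normrN ger0_norm ?fine_ge0//.
  by rewrite -lee_fin fineK ?fin_num_measure ?probability_le1//;
    exact: measurable_left_half.
- move=> mu nu; rewrite mul1e; apply: ge_ereal_sup => _ [x _ <-].
  have mA := measurable_left_half.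
  rewrite [X in enorm X](_ : _ =
      (fine (nu [set x | x.1 < 0]) - fine (mu [set x | x.1 < 0]), 0)).
  2: by congr pair => /=; ring.
  rewrite enorm_axis distrC /L1dist.
  (* The Hahn decomposition chosen inside [L1dist] is abstracted as [PN]; its variation is monotone
     and dominates the charge of each measurable set. *)
  move: (projT2 (cid (projT2 (cid (Hahn_decomposition (diff_charge mu nu))))))
    => PN.
  have mono : (charge_variation PN [set x | (x.1 < 0)%R] <=
      charge_variation PN setT)%E by apply: le_measure; rewrite ?inE.
  apply: le_trans mono.
  apply: le_trans (abse_charge_variation PN mA).
  rewrite /diff_charge /= /cadd /copp /=.
  by rewrite -abse_EFin EFinB !fineK// fin_num_measure.
Qed.

End drift.

(** * Continuity, measurability and differentiation in space-time *)

Lemma pair_continuousr (T U : topologicalType) (u : T) :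
  continuous (fun x : U => (u, x)).
Proof.
by move=> x; apply: (@cvg_pair _ _ _ _ (nbhs u) (nbhs x));
  [exact: cvg_cst|exact: cvg_id].
Qed.

Lemma pair_continuousl (T U : topologicalType) (u : U) :
  continuous (fun x : T => (x, u)).
Proof.
by move=> x; apply: (@cvg_pair _ _ _ _ (nbhs x) (nbhs u));
  [exact: cvg_id|exact: cvg_cst].
Qed.

Section functions_of_time_and_place.
Context {R : realType}.
Implicit Types (f g : R * (R * R) -> R) (t : R) (x : R * R).

(** The domain carries the product sigma-algebra; the Caratheodory criterion reduces the claim to
    continuity in each variable separately. *)
Lemma measurable_fun_continuous_plane (g : R * R -> R) :
  continuous g -> measurable_fun setT g.
Proof.
move=> cg; apply: measurable_fun_caratheodory => [u|v].
- apply: continuous_measurable_fun => v.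
  by apply: continuous_comp; [exact: pair_continuousr|exact: cg].
- move=> u.
  by apply: continuous_comp; [exact: pair_continuousl|exact: cg].
Qed.

Lemma measurable_fun_continuous_space_time g :
  continuous g -> measurable_fun setT g.
Proof.
move=> cg; apply: measurable_fun_caratheodory => [u|v].
- apply: measurable_fun_continuous_plane => v.
  by apply: continuous_comp; [exact: pair_continuousr|exact: cg].
- move=> u.
  by apply: continuous_comp; [exact: pair_continuousl|exact: cg].
Qed.

Lemma bounded_compact_support (V : normedModType R) (K : set V) (g : V -> R) :
  continuous g -> compact K -> (forall z, ~ K z -> g z = 0) ->
  exists C, forall z, `|g z| <= C.
Proof.
move=> cg cK g0.
have /compact_bounded[M [_ gM]] : compact (g @` K).
  by apply: continuous_compact => //; exact: continuous_subspaceT.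
exists (Num.max (M + 1) 0) => z; have [Kz|/g0->] := pselect (K z).
  by rewrite le_max (gM (M + 1)) ?ltrDl//; exists z.
by rewrite normr0 le_max lexx orbT.
Qed.

(** The function vanishes on the open complement of its support, hence near [z]. This makes the
    derivatives of a test function compactly supported, and so bounded. *)
Lemma derive_eq0_off_support (V : normedModType R) (f : V -> R) (u z : V) :
  ~ closure [set z | f z != 0] z -> 'D_u f z = 0.
Proof.
move=> nz; rewrite (@near_eq_derive _ _ _ f (cst 0)) ?derive_cst//.
have oU : open (~` closure [set z | f z != 0]).
  exact/closed_openC/closed_closure.
have : nbhs z (~` closure [set z | f z != 0]) by exact: open_nbhs_nbhs.
apply: filterS => y ny; apply/eqP; apply: contrapT => fy0; apply: ny.
by apply: subset_closure; apply/negP.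
Qed.

Lemma continuous_path (c : R -> R) (v : R) :
  continuous c -> continuous (fun t => (t, (c t, v))).
Proof.
move=> cc t; apply: (@cvg_pair _ _ _ _ (nbhs t) (nbhs (c t, v))).
  exact: cvg_id.
apply: (@cvg_pair _ _ _ _ (nbhs (c t)) (nbhs v)); first exact: cc.
exact: cvg_cst.
Qed.

(** Chain rule: along a curve moving in the first space coordinate only, with velocity [(dc1, 0)],
    the weak integrand is a total time derivative. *)
Lemma is_derive_path f (c1 : R -> R) (v t dc1 : R) :
  differentiable f (t, (c1 t, v)) -> is_derive t 1 c1 dc1 ->
  is_derive t 1 (fun t => f (t, (c1 t, v)))
    (dt f t (c1 t, v) + dot (gradx f t (c1 t, v)) (dc1, 0)).
Proof.
move=> df dc.
pose c (t : R) : R * (R * R) := (t, (c1 t, v)).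
have dfc : differentiable c1 t by apply/derivable1_diffP; have [] := dc.
have dc' : differentiable c t.
  by apply: differentiable_pair => //; apply: differentiable_pair.
have dfc' : differentiable (f \o c) t by exact: differentiable_comp.
apply: DeriveDef; first exact/derivable1_diffP.
rewrite deriveE// diff_comp//=.
have -> : 'd c t 1 = (1, (dc1, 0)).
  rewrite /c diff_pair//=; last by apply: differentiable_pair.
  rewrite diff_pair//= diff_cst -!deriveE// derive_id.
  by rewrite (derive_val (is_derive := dc)).
(* The velocity is split along the two directions defining [dt] and the first component of
   [gradx]. *)
rewrite (_ : (1, (dc1, 0)) = (1, (0, 0)) + dc1 *: (0, (1, 0))); last first.
  by congr (_, (_, _)) => /=; rewrite ?scaler0 ?addr0 ?add0r// [RHS]mulr1.
by rewrite linearD linearZ /= /dt /gradx /dot/= mulr0 addr0 !deriveE// mulrC.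
Qed.

End functions_of_time_and_place.

(** * The weak formulation, integrated along trajectories *)

Section weak_formulation.
Context {R : realType} {p : R} (p1 : 1 <= p) (a : R).
Hypotheses (a0 : 0 <= a) (sqrt_a : Num.sqrt a = 2 * a) (a1 : a <= 1).
Variable f : R * (R * R) -> R.
Hypothesis ftest : test_function 1 f.

Let lambda := @lebesgue_measure R.
Let P := @square_prob R.
Let D1 := fun z => 'D_((1, (0, 0)) : R * (R * R)) f z.
Let D2 := fun z => 'D_((0, (1, 0)) : R * (R * R)) f z.
(** Trajectories in space-time: [w.1] is the time and [w.2] labels a particle by its point of the
    unit square. *)
Let path (w : measurableTypeR R * (measurableTypeR R * measurableTypeR R)) :
  R * (R * R) := (w.1, shift_sqr (a * (w.1 : R) ^+ 2) w.2).
(** The time derivative of [f] along a trajectory, whose horizontal velocity is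
    [- (2 * a * w.1)]. *)
Let H w : R := D1 (path w) + D2 (path w) * (- (2 * a * w.1)).
Let strip : set (measurableTypeR R * (measurableTypeR R * measurableTypeR R)) :=
  `[0, 1]%classic `*` setT.
(** Extension by zero outside the time interval, so that Fubini applies on the whole product. *)
Let h := (EFin \o H) \_ strip.
Let law_path t : Pp R p := Plaw p1 (a * t ^+ 2).

Let diff_f z : differentiable f z.
Proof. by have [/(_ 1%N)[] ] := ftest. Qed.

Let continuous_D u : continuous (fun z => 'D_u f z).
Proof. by have [/(_ 1%N)[_] ] := ftest. Qed.

Let measurable_D u : measurable_fun setT (fun z => 'D_u f z).
Proof.
apply: (@measurable_fun_continuous_space_time R (fun z => 'D_u f z)).
exact: continuous_D.
Qed.

Let bounded_D u : exists C, forall z, `|'D_u f z| <= C.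
Proof.
have [_ cf _] := ftest.
by apply: bounded_compact_support cf _ => // z; exact: derive_eq0_off_support.
Qed.

Let vanish t x : ~~ (0 < t < 1) -> f (t, x) = 0.
Proof.
move=> t01; have [_ _ fs] := ftest; apply/eqP; apply: contraNT t01 => ftx.
by have /= := fs (t, x); apply; exact: subset_closure.
Qed.

Let measurable_path : measurable_fun setT path.
Proof.
apply: measurable_fun_pair; first exact: measurable_fst.
apply: measurable_fun_pair.
  apply: measurable_funB.
    by apply: measurable_funX; apply: measurableT_comp => //;
      exact: measurable_snd.
  by apply: measurable_funM => //; apply: measurable_funX;
    exact: measurable_fst.
by apply: measurableT_comp => //; exact: measurable_snd.
Qed.

Let measurable_H : measurable_fun setT H.
Proof.
apply: measurable_funD.
  exact: (measurableT_comp (measurable_D _) measurable_path).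
apply: measurable_funM.
  exact: (measurableT_comp (measurable_D _) measurable_path).
by apply: measurableT_comp => //; apply: measurable_funM.
Qed.

Let bounded_H : exists C, forall w, strip w -> `|H w| <= C.
Proof.
have [C1 D1C] := bounded_D (1, (0, 0)); have [C2 D2C] := bounded_D (0, (1, 0)).
exists (C1 + C2 * (2 * a)) => w [/= + _]; rewrite in_itv/= => /andP[t0 t1].
apply: (le_trans (ler_normD _ _)); rewrite lerD ?D1C// normrM ler_pM ?D2C//.
by rewrite normrN ger0_norm ?mulr_ge0// ler_piMr// mulr_ge0.
Qed.

Let measurable_strip : measurable strip.
Proof. by apply: measurableX. Qed.

Let integrable_h : (lambda \x P)%E.-integrable setT h.
Proof.
apply/(integrable_mkcond _ measurable_strip).
apply: measurable_bounded_integrable => //.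
- apply: (@le_lt_trans _ _ 1%E); last exact: ltry.
  rewrite [leLHS](product_measure1E lambda P)//=.
  rewrite [X in (_ * X)%E](@probability_setT _ _ _ P) mule1.
  by rewrite [leLHS]lebesgue_measure_itv/= lte_fin ltr01 oppr0 adde0.
- exact: measurable_funTS.
- have [C HC] := bounded_H; exists C; split; first exact: num_real.
  by move=> x Cx w sw; apply: (le_trans (HC w sw)); exact: ltW.
Qed.

(** The differential equation enters here: sqrt (a t^2) = (sqrt a) t = 2 a t. The bound [a <= 1]
    keeps a t^2 in [0, 1], where the mass of the half-plane is known. *)
Let drift_law_path t x : 0 <= t <= 1 ->
  drift (law_path t) x = (- (2 * a * t), 0).
Proof.
move=> /andP[t0 t1].
have at01 : 0 <= a * t ^+ 2 <= 1.
  rewrite mulr_ge0 ?sqr_ge0//= (@le_trans _ _ a)// ler_piMr//.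
  by rewrite expr_le1.
have lawE : law_path t [set x | x.1 < 0] = (2 * a * t)%:E.
  apply: etrans (law_left_half at01) _.
  by rewrite sqrtrM// sqrtr_sqr sqrt_a (ger0_norm t0).
by rewrite /drift lawE.
Qed.

(** Change of variables: the law at time t is an image of the uniform law on the square, so the
    integral becomes one over particles, against a measure independent of time. *)
Let weak_integrandE t : 0 <= t <= 1 ->
  weak_integrand drift law_path f t = fubini_F P h t.
Proof.
move=> t01; rewrite /fubini_F.
pose G (x : R * R) : R := D1 (t, x) + D2 (t, x) * (- (2 * a * t)).
transitivity (\int[law (a * t ^+ 2)]_x (G x)%:E)%E.
  apply: eq_integral => x _.
  congr (_ + _)%:E.
  rewrite (drift_law_path x t01).
  by rewrite /dot [X in _ + X]mulr0 addr0.
have mG : measurable_fun setT G.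
  apply: measurable_funD.
    apply: (measurable_fun_pair2 (f := D1)).
    exact: measurable_D.
  apply: measurable_funM => //.
  apply: (measurable_fun_pair2 (f := D2)).
  exact: measurable_D.
rewrite integral_distribution; last 2 first.
- exact/measurable_EFinP.
- apply: measurable_bounded_integrable => //.
  + by rewrite [ltLHS](@probability_setT _ _ _ P) ltry.
  + exact: measurableT_comp.
  + have [C HC] := bounded_H; exists C; split; first exact: num_real.
    move=> x Cx z _; apply: (le_trans _ (ltW Cx)).
    by apply: (HC (t, z)); split => //=; rewrite in_itv.
by apply: eq_integral => z _; rewrite /h patchE mem_set.
Qed.

(** For a fixed particle, [H] is the derivative of [F], that is of [f] along its trajectory. The
    fundamental theorem of calculus leaves boundary terms at times 0 and 1, where a test function
    vanishes. *)
Let inner_integral0 z : fubini_G lambda h z = 0%E.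
Proof.
transitivity (\int[lambda]_(t in `[0%R, 1%R]) (H (t, z))%:E)%E.
  rewrite [RHS]integral_mkcond; apply: eq_integral => t _.
  rewrite /h !patchE; congr (if _ then _ else _).
  by apply/idP/idP; rewrite !inE /strip /=; [case|].
pose F (t : R) := f (t, ((z.1 : R) ^+ 2 - a * t ^+ 2, z.2)).
have dpath (t : R) : is_derive t 1 (fun t : R => (z.1 : R) ^+ 2 - a * t ^+ 2)
    (- (2 * a * t)).
  by apply: is_derive_eq; rewrite /GRing.scale/=; ring.
have dF (t : R) : is_derive t 1 F (H (t, z)).
  have D := @is_derive_path _ f _ z.2 t _ (diff_f _) (dpath t).
  by apply: (is_derive_eq D); rewrite /dot [X in _ + (_ + X)]mulr0 addr0.
have cF : continuous F.
  move=> t; apply: differentiable_continuous; apply/derivable1_diffP.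
  exact: ex_derive.
have cpath : continuous (fun t : R => path (t, z)).
  apply: continuous_path => t.
  by apply: differentiable_continuous; apply/derivable1_diffP; exact: ex_derive.
have cD u : continuous (fun t : R => 'D_u f (path (t, z))).
  move=> t; apply: (@continuous_comp _ _ _ (fun t => path (t, z)) ('D_u f)).
    exact: cpath.
  exact: continuous_D.
have cH : continuous (fun t : R => H (t, z)).
  move=> t; apply: cvgD; first exact: cD.
  apply: cvgM; first exact: cD.
  by apply: cvgN; exact: mulrl_continuous.
rewrite (@continuous_FTC2 _ _ F) => //.
- by rewrite /F !vanish ?ltxx ?andbF// subee.
- exact: continuous_subspaceT.
- split=> [t _||]; first exact: ex_derive.
  + exact/cvg_at_right_filter/cF.
  + exact/cvg_at_left_filter/cF.
- by move=> t _; rewrite derive1E (derive_val (is_derive := dF t)).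
Qed.

(** Fubini allows integrating in time first, and then each particle contributes zero. It also yields
    the integrability in time. *)
Lemma weak_law_path :
  lambda.-integrable `[0, 1] (weak_integrand drift law_path f) /\
  (\int[lambda]_(t in `[0%R, 1%R]) weak_integrand drift law_path f t = 0)%E.
Proof.
have F0 : {in `[0, 1]%classic,
    fubini_F P h =1 weak_integrand drift law_path f}.
  by move=> t; rewrite inE/= in_itv/= => t01; rewrite weak_integrandE.
have iF := integrable_fubini_F integrable_h.
split.
  apply: (eq_integrable _ (fubini_F P h)) => //.
  exact: (integrableS measurableT).
transitivity (\int[lambda]_(t in `[0%R, 1%R]) fubini_F P h t)%E.
  by apply: eq_integral => t t01; rewrite F0.
(* Outside [0, 1] the cut-off in [h] makes the inner integral zero, so the time integral extends to
   the whole line. *)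
transitivity (\int[lambda]_t fubini_F P h t)%E.
  rewrite integral_mkcond; apply: eq_integral => t _; rewrite patchE.
  case: ifPn => // /negP tn; rewrite /fubini_F integral0_eq// => z _.
  rewrite /h patchE ifF//; apply/negP; rewrite inE => -[/= t01 _].
  by apply: tn; rewrite inE.
rewrite [LHS](Fubini integrable_h) -[RHS](@integral0 _ _ _ P setT).
by apply: eq_integral => z _; exact: inner_integral0.
Qed.

End weak_formulation.

(** * The two solutions *)

(** The distance is squeezed between 0 and |a s^2 - a t^2|, which is continuous in s. *)
Lemma wasserstein_law_path (R : realType) (p : R) (p1 : 1 <= p) (a t : R)
    (A : set R) :
  wasserstein p (Plaw p1 (a * s ^+ 2)) (Plaw p1 (a * t ^+ 2))
    @[s --> within A (nbhs t)] --> 0%E.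
Proof.
apply: (@squeeze_cvge _ _ _ _ (cst 0%E) _
  (fun s => `|a * s ^+ 2 - a * t ^+ 2|%:E)).
- apply: nearW => s; rewrite poweR_ge0/=.
  by apply: wasserstein_law; exact: lt_le_trans p1.
- exact: cvg_cst.
apply: cvg_EFin; first exact: nearW.
apply: cvg_within_filter.
have : `|a * s ^+ 2 - a * t ^+ 2| @[s --> t] --> `|a * t ^+ 2 - a * t ^+ 2|.
  apply: cvg_norm; apply: cvgB; last exact: cvg_cst.
  by apply: cvgM; [exact: cvg_cst|exact: exprn_continuous].
by rewrite subrr normr0.
Qed.

Lemma law_path_solution (R : realType) (p : R) (p1 : 1 <= p) (a : R) :
  0 <= a <= 1 -> Num.sqrt a = 2 * a ->
  is_solution drift 1 (Plaw p1 0) (fun t => Plaw p1 (a * t ^+ 2)).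
Proof.
move=> /andP[a0 a1] sqrt_a; split.
- by move=> t _; exact: law_ac_compact.
- by move=> t _; exact: wasserstein_law_path.
- by move=> A _; rewrite expr0n mulr0.
- by move=> f ftest; exact: weak_law_path.
Qed.

Theorem mainTheorem7 (R : realType) (p : R) (hp : 1 <= p) :
  exists (v : Pp R p -> R * R -> R * R) (mu0 : Pp R p),
    [/\ H1 v,
        ac_compact mu0 &
        exists mu1 mu2 : R -> Pp R p,
          [/\ is_solution v 1 mu0 mu1,
              is_solution v 1 mu0 mu2 &
              exists t : R, t \in `[0, 1] /\ ~ same_measure (mu1 t) (mu2 t)]].
Proof.
exists drift, (Plaw hp 0); split.
- exact: drift_H1.
- exact: law_ac_compact.
(* The two roots of sqrt a = 2 a; 1/4 is written as a square so that its root simplifies. *)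
exists (fun t => Plaw hp (0 * t ^+ 2)), (fun t => Plaw hp (2^-1 ^+ 2 * t ^+ 2)).
split.
- by apply: law_path_solution; rewrite ?lexx ?ler01// sqrtr0 mulr0.
- apply: law_path_solution; first by apply/andP; split; nra.
  by rewrite sqrtr_sqr ger0_norm// expr2 mulrA mulfV// mul1r.
(* At time 1 the left half-plane has mass 0 for the first solution and 1/2 for the second. *)
exists 1; split; first by rewrite in_itv/= ler01 lexx.
move=> /(_ _ measurable_left_half); rewrite mul0r expr1n mulr1 => E.
have q01 : 0 <= (2^-1 : R) ^+ 2 <= 1 by apply/andP; split; nra.
have z01 : 0 <= (0 : R) <= 1 by rewrite lexx ler01.
have {E} := etrans (esym (law_left_half z01)) (etrans E (law_left_half q01)).
rewrite sqrtr0 sqrtr_sqr ger0_norm; last by rewrite invr_ge0.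
by move=> [] /eqP; rewrite eq_sym invr_eq0 pnatr_eq0.
Qed.
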